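(* Let $(X,\|\cdot\|_X)$ be a two-dimensional real normed space such that $S_X$ is piecewise $C^1$-differentiable and such that there exist two linearly independent points $x,\overline{x}\in S_X$ at which $\|\cdot\|_X$ is not differentiable. Then for every two-dimensional real normed space $(Y,\|\cdot\|_Y)$, every surjective isometry $\tau:S_X\to S_Y$ (i.e. $\|\tau(u)-\tau(v)\|_Y=\|u-v\|_X$ for all $u,v\in S_X$) is linear, i.e. it is the restriction to $S_X$ of a linear map $X\to Y$ (which is then a linear isometry).
   Context: $S_X=\{x\in X:\|x\|_X=1\}$ denotes the unit sphere. $S_X$ is called piecewise $C^1$-differentiable if the norm $\|\cdot\|_X$ fails to be differentiable at only finitely many points of $S_X$. *)

(* Defs.v *)
From HB Require Import structures.
From mathcomp Require Import all_boot all_order all_algebra.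
From mathcomp Require Import all_classical all_reals all_analysis.
Set Implicit Arguments. Unset Strict Implicit. Unset Printing Implicit Defensive.
Import Order.TTheory GRing.Theory Num.Theory.
Import numFieldNormedType.Exports.
Local Open Scope classical_set_scope.
Local Open Scope ring_scope.

Definition two_dimensional (R : realType) (X : normedModType R) : Prop :=
  exists e1 e2 : X,
    (forall a b : R, a *: e1 + b *: e2 = 0 -> a = 0 /\ b = 0) /\
    (forall x : X, exists a b : R, x = a *: e1 + b *: e2).

Definition unit_sphere (R : realType) (X : normedModType R) : set X :=
  [set x : X | `|x| = 1].

Definition normfun (R : realType) (X : normedModType R) : X -> R :=
  fun x => `|x|.

Definition sphere_piecewise_C1 (R : realType) (X : normedModType R) : Prop :=
  finite_set [set x : X | `|x| = 1 /\ ~ differentiable (@normfun R X) x].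

Definition lin_indep2 (R : realType) (X : normedModType R) (x y : X) : Prop :=
  forall a b : R, a *: x + b *: y = 0 -> a = 0 /\ b = 0.

(* Main.v *)
(** The chords of the sphere parallel to a kink [x] of the norm are metrically
    visible: for two such chords at distance [h], the sum of the diagonals
    exceeds the sum of the parallel sides by at least a constant times [h],
    whereas near a direction of differentiability the excess would be [o(h)].
    Hence [tau] sends these chords to chords in kink directions of [Y].  Every
    kink is the unique maximiser of a rational functional, so there are only
    countably many of them and, by continuity, the image direction is constant.
    Knowing that parallel chords go to parallel chords, the lengths of the
    diagonals determine the first-order behaviour of [tau]: both one-sided
    derivatives of the norm at the kink are recovered, and they are linearly
    independent.  So [tau] is affine on the union of the open arcs swept by the
    chords, i.e. off the flat parts of the sphere parallel to [x].  A second
    kink handles these flat parts, and an affine map which carries the unit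
    sphere of [X] isometrically onto that of [Y] has no translation part. *)

Require Import Defs.
From HB Require Import structures.
From mathcomp Require Import all_boot all_order all_algebra.
From mathcomp Require Import all_classical all_reals all_analysis.
From mathcomp Require Import ring lra.
Import Order.TTheory GRing.Theory Num.Theory.
Import numFieldNormedType.Exports.
Local Open Scope classical_set_scope.
Local Open Scope ring_scope.

Set Implicit Arguments. Unset Strict Implicit. Unset Printing Implicit Defensive.

(** * Real functions governed by their small increments *)

Lemma lipschitz_within_continuous (R : realType) (f : R -> R) (c d K : R) :
  (forall s t, c <= s <= d -> c <= t <= d -> `|f s - f t| <= K * `|s - t|) ->
  {within `[c, d], continuous f}.
Proof.
move=> fK; apply/subspace_continuousP => s /= scd.
apply/cvgrPdist_le => e e0.
have K1 : 0 < `|K| + 1 by rewrite ltr_wpDl.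
have : \forall t \near s, t \in `[c, d] -> `|f s - f t| <= e; last by [].
near=> t => tcd.
have := fK s t; rewrite !in_itv /= in scd tcd; move=> /(_ scd tcd) h.
apply: (le_trans h).
have st : `|s - t| <= e / (`|K| + 1).
  near: t; apply/nbhs_ballP; exists (e / (`|K| + 1)); first by rewrite /= divr_gt0.
  by move=> y /ltW.
rewrite ler_pdivlMr // in st.
apply: le_trans st; rewrite mulrC ler_wpM2l //.
by rewrite (le_trans (ler_norm K)) // lerDl.
Unshelve. all: by end_near. Qed.

Lemma grid_step (R : realType) (l delta : R) :
  0 < delta -> exists n : nat, l / n.+1%:R < delta.
Proof.
move=> d0; exists (Num.bound `|l / delta|).
rewrite ltr_pdivrMr ?ltr0n // mulrC -ltr_pdivrMr //.
apply: le_lt_trans (ler_norm _) _.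
by apply: lt_le_trans (archi_boundP (normr_ge0 _)) _; rewrite ler_nat.
Qed.

(** Telescoping along a uniform grid of mesh below [delta], supplied by [grid_step]. *)
Lemma chained_bound (R : realType) (f : R -> R) (c d delta K : R) :
  0 < delta -> c <= d ->
  (forall s t, c <= s -> s <= t -> t <= d -> t - s < delta ->
    `|f t - f s| <= K * (t - s)) ->
  `|f d - f c| <= K * (d - c).
Proof.
move=> delta0 cd fK; have [n hn] := @grid_step _ (d - c) _ delta0.
set h := (d - c) / n.+1%:R in hn.
have h0 : 0 <= h by rewrite divr_ge0 ?subr_ge0.
have hnE : h *+ n.+1 = d - c.
  by rewrite -mulr_natr /h divfK // pnatr_eq0.
have : forall k, (k <= n.+1)%N -> `|f (c + h *+ k) - f c| <= K * (h *+ k).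
  elim=> [|k IH] kn; first by rewrite mulr0n addr0 subrr normr0 mulr0.
  have hk0 : 0 <= h *+ k by rewrite mulrn_wge0.
  have hkn : h *+ k.+1 <= d - c by rewrite -hnE -(mulr_natr h k.+1) -(mulr_natr h n.+1) ler_wpM2l // ler_nat.
  have := fK (c + h *+ k) (c + h *+ k.+1); move: hkn; rewrite !(mulrSr h k) => hkn.
  have -> : c + (h *+ k + h) - (c + h *+ k) = h by ring.
  move=> /(_ _ _ _ hn) F; have := IH (ltnW kn).
  have := F ltac:(lra) ltac:(lra) ltac:(lra).
  have := ler_normD (f (c + (h *+ k + h)) - f (c + h *+ k)) (f (c + h *+ k) - f c).
  by rewrite addrA subrK mulrDr; lra.
by move/(_ n.+1 (leqnn _)); rewrite hnE; have -> : c + (d - c) = d by ring.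
Qed.

Lemma constant_of_small_increments (R : realType) (f : R -> R) (c d : R) :
  c <= d ->
  (forall eps, 0 < eps -> exists2 delta, 0 < delta & forall s t, c <= s ->
    s <= t -> t <= d -> t - s < delta -> `|f t - f s| <= eps * (t - s)) ->
  f d = f c.
Proof.
move=> cd fe; apply/eqP; rewrite -subr_eq0 -normr_le0; apply/ler_addgt0Pr => e e0.
rewrite add0r.
have e1 : 0 < e / (1 + (d - c)) by rewrite divr_gt0 //; lra.
have [delta delta0 fd] := fe _ e1.
have /le_trans := chained_bound delta0 cd fd; apply.
rewrite mulrAC ler_pdivrMr; last by lra.
by rewrite ler_pM2l //; lra.
Qed.

(* Two consecutive increments of opposite signs would nearly cancel. *)
Lemma same_sign_step (R : realType) (k e u v : R) : 0 < k -> e <= k / 4 ->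
  `| `|u| - k| <= e -> `| `|v| - k| <= e -> `| `|v + u| - (k + k)| <= e + e ->
  k - e <= u -> k - e <= v.
Proof.
move=> k0 ek + + + u0; have -> : `|u| = u by apply: ger0_norm; lra.
rewrite !ler_norml; case: (ger0P v) => v0; first lra.
by case: (ger0P (v + u)); lra.
Qed.

(** The upper bound is chained. For the lower bound, increments over consecutive grid steps must not
    cancel: the increment over a double step is also nearly [k * (h + h)] in absolute value, so
    every step has the sign of the first one and the sizes add up. *)
Lemma isometric_of_infinitesimally_isometric (R : realType) (f : R -> R) (c d k : R) :
  c <= d -> 0 < k ->
  (forall eps, 0 < eps -> exists2 delta, 0 < delta & forall s t, c <= s ->
    s <= t -> t <= d -> t - s < delta ->
    `| `|f t - f s| - k * (t - s)| <= eps * (t - s)) ->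
  `|f d - f c| = k * (d - c).
Proof.
move=> cd k0 fe; apply/eqP; rewrite -subr_eq0 -normr_le0; apply/ler_addgt0Pr => e e0.
rewrite add0r.
(* [k / 4] is the tolerance of [same_sign_step]; the other entry brings the total error
   [E * (d - c)] below [e]. *)
have e1 : 0 < Num.min (k / 4) (e / (1 + (d - c))).
  by rewrite lt_min !divr_gt0 //; lra.
have [delta delta0 fd] := fe _ e1.
set E := Num.min _ _ in e1 fd.
have Ek : E <= k / 4 by rewrite ge_min lexx.
have Ed : E * (d - c) <= e.
  have : E <= e / (1 + (d - c)) by rewrite ge_min lexx orbT.
  rewrite ler_pdivlMr; last by lra.
  by rewrite mulrDr; lra.
apply: le_trans Ed; rewrite ler_norml; apply/andP; split; last first.
  suff : `|f d - f c| <= (k + E) * (d - c) by rewrite mulrDl; lra.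
  apply: (chained_bound delta0 cd) => s t cs st td ts.
  by have := fd s t cs st td ts; rewrite ler_norml mulrDl; lra.
suff : (k - E) * (d - c) <= `|f d - f c| by rewrite mulrBl; lra.
(* Half of [delta], so that the hypothesis also covers double steps. *)
have d20 : 0 < delta / 2 by lra.
have [n hn] := @grid_step _ (d - c) _ d20.
set h := (d - c) / n.+1%:R in hn.
have h0 : 0 <= h by rewrite divr_ge0 ?subr_ge0.
have hnE : h *+ n.+1 = d - c.
  by rewrite -mulr_natr /h divfK // pnatr_eq0.
have [->|h_neq0] := eqVneq d c; first by rewrite !subrr mulr0 normr0.
have {}h0 : 0 < h.
  by rewrite divr_gt0 // subr_gt0 lt_neqAle eq_sym h_neq0.
clear h_neq0.
(* Stated for an arbitrary [g], to be applied to [f] or to [- f] according to the sign of the first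
   increment. *)
have same_sign (g : R -> R) : (forall s t, c <= s -> s <= t -> t <= d ->
    t - s < delta -> `| `|g t - g s| - k * (t - s)| <= E * (t - s)) ->
    0 <= g (c + h) - g c -> (k - E) * (d - c) <= `|g d - g c|.
  move=> gd g0.
  have Ekh : E * h <= k * h / 4 by have := ler_wpM2r (ltW h0) Ek; lra.
  have kh : 0 < k * h by rewrite mulr_gt0.
  have hkn i : (i <= n.+1)%N -> h *+ i <= d - c by move=> ?; rewrite -hnE -(mulr_natr h i) -(mulr_natr h n.+1) ler_wpM2l ?(ltW h0) // ler_nat.
  have step i : (i.+1 <= n.+1)%N -> `| `|g (c + h *+ i.+1) - g (c + h *+ i)| - k * h| <= E * h.
    move=> /hkn; rewrite !(mulrSr h i) => hi.
    have hi0 : 0 <= h *+ i by rewrite mulrn_wge0 // ltW.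
    have := gd (c + h *+ i) (c + (h *+ i + h)) ltac:(lra) ltac:(lra) ltac:(lra).
    have -> : c + (h *+ i + h) - (c + h *+ i) = h by ring.
    by apply; lra.
  have pos i : (i.+1 <= n.+1)%N -> (k - E) * h <= g (c + h *+ i.+1) - g (c + h *+ i).
    elim: i => [|i IH] hi.
      by have := step _ hi; rewrite mulr0n mulr1n addr0 (ger0_norm g0) ler_norml mulrBl; lra.
    have := IH (ltnW hi); have := step _ hi; have := step _ (ltnW hi).
    have := hkn _ hi; rewrite !(mulrSr h i.+1) !(mulrSr h i) => hi'.
    have hi0 : 0 <= h *+ i by rewrite mulrn_wge0 // ltW.
    have := gd (c + h *+ i) (c + (h *+ i + h + h)) ltac:(lra) ltac:(lra) ltac:(lra).
    have -> : c + (h *+ i + h + h) - (c + h *+ i) = h + h by ring.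
    move=> /(_ ltac:(lra)).
    rewrite !mulrDr mulrBl -(subrKA (g (c + (h *+ i + h)))
      (g (c + (h *+ i + h + h))) (- g (c + h *+ i))) => F1 F2 F3 F4.
    exact: same_sign_step kh Ekh F2 F3 F1 F4.
  apply: le_trans (ler_norm _).
  have : forall i, (i <= n.+1)%N -> (k - E) * (h *+ i) <= g (c + h *+ i) - g c.
    elim=> [|i IH] hi; first by rewrite mulr0n mulr0 addr0 subrr.
    have := pos _ hi; have := IH (ltnW hi); rewrite (mulrSr h i) mulrDr; lra.
  by move=> /(_ n.+1 (leqnn _)); rewrite hnE; have -> : c + (d - c) = d by ring.
case: (lerP 0 (f (c + h) - f c)) => fh; first exact: same_sign.
have -> : `|f d - f c| = `|- f d - - f c| by rewrite -opprD normrN.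
apply: (same_sign (fun u => - f u)); last by lra.
by move=> s t cs st td ts; rewrite -opprD normrN; apply: fd.
Qed.

(** A point of the line is determined by its distances to two distinct points, here [f 0] and
    [f 2^-1]; the sign [sg] is read off from these two. *)
Lemma affine_of_isometric (R : realType) (f : R -> R) (k : R) : 0 < k ->
  (forall s t, -1 < s -> s <= t -> t < 1 -> `|f t - f s| = k * (t - s)) ->
  exists2 sg : R, sg = 1 \/ sg = -1 &
    forall t, -1 < t < 1 -> f t = f 0 + sg * k * t.
Proof.
move=> k0 fi.
have norm_or (u v : R) : `|u| = v -> u = v \/ u = - v.
  by move=> <-; case: (ger0P u) => _; [left|right; rewrite opprK].
have h01 : `|f 2^-1 - f 0| = k * (2^-1 - 0) by apply: fi; lra.
have gen sg t : sg = 1 \/ sg = -1 -> f 2^-1 - f 0 = sg * k * 2^-1 ->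
    -1 < t < 1 -> f t = f 0 + sg * k * t.
  move=> hs h2 t1.
  have a1 : `|f t - f 0| = k * `|t|.
    case: (ger0P t) => t0; first by rewrite fi //; lra.
    by rewrite distrC fi; lra.
  have a2 : `|f t - f 2^-1| = k * `|t - 2^-1|.
    case: (ger0P (t - 2^-1)) => t0; first by rewrite fi; lra.
    by rewrite distrC fi; lra.
  (* Squaring removes the absolute values, and the difference of the two squared equations is linear
     in [f t]. *)
  have sqn (u v : R) : `|u| = k * `|v| -> u ^+ 2 = k ^+ 2 * v ^+ 2.
    by move=> e; rewrite -real_normK ?num_real // e exprMn real_normK ?num_real.
  have {}a1 := sqn _ _ a1; have {}a2 := sqn _ _ a2.
  have kn0 : k != 0 by rewrite gt_eqF.
  apply: (mulfI kn0).
  have -> : k * (f 0 + sg * k * t) = k * f 0 + sg * (k ^+ 2 * t) by ring.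
  have e1 : f t - f 2^-1 = (f t - f 0) - sg * k * 2^-1 by rewrite -h2; ring.
  rewrite e1 in a2; move: a1 a2; set u := f t - f 0 => a1 a2.
  have -> : f t = u + f 0 by rewrite subrK.
  by case: hs a2 => ->; lra.
case: (norm_or _ _ h01) => e; [exists 1|exists (-1)]; try by [left|right].
  by move=> t; apply: gen; [left|lra].
by move=> t; apply: gen; [right|lra].
Qed.

(** * Coordinates adapted to a unit vector *)

Lemma combD (R : realType) (V : lmodType R) (x z : V) a b c d :
  (a *: x + b *: z) + (c *: x + d *: z) = (a + c) *: x + (b + d) *: z.
Proof. by rewrite addrACA -!scalerDl. Qed.

Lemma combN (R : realType) (V : lmodType R) (x z : V) a b :
  - (a *: x + b *: z) = (- a) *: x + (- b) *: z.
Proof. by rewrite opprD !scaleNr. Qed.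

Lemma combB (R : realType) (V : lmodType R) (x z : V) a b c d :
  (a *: x + b *: z) - (c *: x + d *: z) = (a - c) *: x + (b - d) *: z.
Proof. by rewrite combN combD. Qed.

Lemma combZ (R : realType) (V : lmodType R) (x z : V) a b c :
  c *: (a *: x + b *: z) = (c * a) *: x + (c * b) *: z.
Proof. by rewrite scalerDr !scalerA. Qed.

(* The last coordinate is a norm-one functional vanishing at [x]: [z] is
   Birkhoff orthogonal to [x]. *)
Definition frame (R : realType) (V : normedModType R) (x z : V) : Prop :=
  [/\ `|x| = 1, `|z| = 1, forall a b : R, `|b| <= `|a *: x + b *: z|
    & forall v : V, exists a b : R, v = a *: x + b *: z].

(** For any [y] independent of [x], the shortest vector of the line [y + R x] is Birkhoff orthogonal
    to [x]; normalising it gives [z]. *)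
Lemma frame_exists (R : realType) (V : normedModType R) (x : V) :
  two_dimensional V -> `|x| = 1 -> exists z : V, frame x z.
Proof.
move=> [e1 [e2 [free span]]] x1.
have [a [b xE]] := span x.
have n0 : a ^+ 2 + b ^+ 2 != 0.
  apply/eqP => n0; have a0 : a = 0 by apply/eqP; rewrite -sqrf_eq0; nra.
  have b0 : b = 0 by apply/eqP; rewrite -sqrf_eq0; nra.
  by move: x1; rewrite xE a0 b0 !scale0r addr0 normr0 => /eqP; rewrite eq_sym oner_eq0.
(* A quarter turn of [x] in the coordinates [e1], [e2]: the determinant of the pair is
   [a ^+ 2 + b ^+ 2]. *)
pose y := (- b) *: e1 + a *: e2.
have combE s t : s *: x + t *: y = (s * a - t * b) *: e1 + (s * b + t * a) *: e2.
  by rewrite xE /y !combZ combD; congr (_ *: _ + _ *: _); ring.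
clearbody y.
have span' v : exists s t, v = s *: x + t *: y.
  have [c [d ->]] := span v.
  exists ((a * c + b * d) / (a ^+ 2 + b ^+ 2)), ((a * d - b * c) / (a ^+ 2 + b ^+ 2)).
  by rewrite combE; congr (_ *: _ + _ *: _); field.
have free' s : s *: x + y != 0.
  apply/eqP => h; have := combE s 1; rewrite scale1r h => /esym /free [h1 h2].
  have : a ^+ 2 + b ^+ 2 = 0.
    have -> : a ^+ 2 + b ^+ 2 = (s * b + 1 * a) * a - (s * a - 1 * b) * b by ring.
    by rewrite h1 h2 !mul0r subr0.
  by apply/eqP.
(* Outside [[- M, M]] the norm of [t *: x + y] exceeds its value at [t = 0], so the minimum over
   this compact interval is global. *)
pose M := 2 * `|y|.
have M0 : 0 <= M by rewrite mulr_ge0.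
have [r0 _ r0min] : exists2 c, c \in `[- M, M] &
    forall t, t \in `[- M, M] -> `|c *: x + y| <= `|t *: x + y|.
  apply: (@EVT_min _ (fun t => `|t *: x + y|)); first by lra.
  apply: (@lipschitz_within_continuous _ _ _ _ 1) => s t _ _.
  apply: le_trans (ler_dist_dist _ _) _.
  by rewrite opprD addrACA subrr addr0 -scalerBl normrZ x1 mulr1 mul1r.
have {}r0min t : `|r0 *: x + y| <= `|t *: x + y|.
  have [tM|tM] := lerP `|t| M; first by apply: r0min; rewrite in_itv /= -ler_norml.
  have := r0min 0; rewrite in_itv /= scale0r add0r => /(_ ltac:(lra)) h.
  apply: le_trans h _; have := lerB_normD (t *: x) y.
  by rewrite normrZ x1 mulr1; rewrite /M in tM; lra.
pose m := `|r0 *: x + y|.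
have m0 : 0 < m by rewrite normr_gt0.
have mn0 : m != 0 by rewrite gt_eqF.
exists (m^-1 *: (r0 *: x + y)); split=> //.
- by rewrite normrZ gtr0_norm ?invr_gt0 // mulVf.
- move=> s t; have [->|t0] := eqVneq t 0; first by rewrite normr0.
  have -> : s *: x + t *: (m^-1 *: (r0 *: x + y)) =
      (t / m) *: ((s / (t / m) + r0) *: x + y).
    rewrite scalerA !scalerDr addrA !scalerA -scalerDl.
    by congr (_ *: _ + _); field; rewrite t0 mn0.
  rewrite normrZ normrM (gtr0_norm (x := m^-1)) ?invr_gt0 //.
  rewrite -mulrA ler_peMr // mulrC ler_pdivlMr // mul1r.
  exact: r0min.
- move=> v; have [s [t ->]] := span' v.
  exists (s - t * r0), (t * m).
  rewrite scalerA -mulrA mulfV // mulr1 scalerDr addrA scalerA -scalerDl.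
  by rewrite subrK.
Qed.

Lemma frame_inj (R : realType) (V : normedModType R) (x z : V) a b c d :
  frame x z -> a *: x + b *: z = c *: x + d *: z -> a = c /\ b = d.
Proof.
move=> [x1 _ le _] /eqP; rewrite -subr_eq0 combB => /eqP h.
have bd : b = d.
  by have := le (a - c) (b - d); rewrite h normr0 normr_le0 subr_eq0 => /eqP.
split=> //; move: h; rewrite bd subrr scale0r addr0 => /eqP.
by rewrite scaler_eq0 subr_eq0 -[x == 0]normr_eq0 x1 oner_eq0 orbF => /eqP.
Qed.

Lemma frame_coord1 (R : realType) (V : normedModType R) (x z : V) a b :
  frame x z -> `|a| <= 2 * `|a *: x + b *: z|.
Proof.
move=> [x1 z1 le _]; have := le a b.
have := ler_normB (a *: x + b *: z) (b *: z).
by rewrite addrK !normrZ x1 z1 !mulr1; lra.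
Qed.

Lemma frame_linear (R : realType) (V : normedModType R) (x z : V)
  (W : lmodType R) (p q : W) : frame x z ->
  exists L : {linear V -> W}, forall a b, L (a *: x + b *: z) = a *: p + b *: q.
Proof.
move=> fr; have [_ _ _ span] := fr.
have /choice [f fP] : forall v, exists ab : R * R, v = ab.1 *: x + ab.2 *: z.
  by move=> v; have [a [b ->]] := span v; exists (a, b).
pose L v := (f v).1 *: p + (f v).2 *: q.
have LE a b : L (a *: x + b *: z) = a *: p + b *: q.
  by rewrite /L; have [<- <-] := frame_inj fr (fP (a *: x + b *: z)).
have linL : linear L.
  move=> k u v; have [a [b ->]] := span u; have [c [d ->]] := span v.
  by rewrite combZ combD !LE combZ combD.
pose LM := GRing.isLinear.Build R V W *:%R L linL.
pose LL : {linear V -> W} := HB.pack L LM.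
by exists LL => a b; exact: LE.
Qed.

Lemma frame_linear_bounded (R : realType) (V W : normedModType R) (x z : V)
  (L : {linear V -> W}) : frame x z ->
  exists2 K : R, 0 < K & forall v, `|L v| <= K * `|v|.
Proof.
move=> fr; exists (2 * `|L x| + `|L z| + 1).
  by have := normr_ge0 (L x); have := normr_ge0 (L z); lra.
move=> v; have [_ _ le span] := fr; have [a [b ->]] := span v.
have ha := frame_coord1 a b fr; have hb := le a b.
rewrite linearD !linearZ /=; apply: le_trans (ler_normD _ _) _.
rewrite !normrZ.
have := ler_wpM2r (normr_ge0 (L x)) ha; have := ler_wpM2r (normr_ge0 (L z)) hb.
by have := normr_ge0 (a *: x + b *: z); lra.
Qed.

(** The exit parameter is the supremum of the parameters at which the ray is in the ball. Taking the
    last such parameter matters when the ray runs along a flat part of the sphere. *)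
Lemma ray_exit (R : realType) (V : normedModType R) (v x : V) :
  `|v| <= 1 -> `|x| = 1 ->
  exists s : R, [/\ 0 <= s, `|v + s *: x| = 1 &
    forall t, s < t -> 1 < `|v + t *: x|].
Proof.
move=> v1 x1.
pose A := [set s : R | `|v + s *: x| <= 1].
have A0 : A 0 by rewrite /A /= scale0r addr0.
have ubA : has_ubound A.
  exists 2 => s; rewrite /A /= => h.
  have := ler_normB (v + s *: x) v; rewrite addrAC subrr add0r normrZ x1 mulr1.
  by have := ler_norm s; lra.
have supA : has_sup A by split=> //; exists 0.
have lip s t : `|v + s *: x| <= `|v + t *: x| + `|s - t|.
  have -> : v + s *: x = v + t *: x + (s - t) *: x by rewrite -addrA -scalerDl subrKC.
  by apply: le_trans (ler_normD _ _) _; rewrite [in leLHS]normrZ x1 mulr1.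
have le1 : `|v + sup A *: x| <= 1.
  apply/ler_addgt0Pr => e e0.
  have [s As hs] := sup_adherent e0 supA.
  have sA := ub_le_sup ubA As.
  have := lip (sup A) s; rewrite ger0_norm ?subr_ge0 // /A /= in As *.
  by lra.
have gt1 t : sup A < t -> 1 < `|v + t *: x|.
  by move=> h; rewrite ltNge; apply/negP => /(ub_le_sup ubA); rewrite leNgt h.
exists (sup A); split=> //; first exact: ub_le_sup.
apply/eqP; rewrite eq_le le1 /= leNgt; apply/negP => h.
set d := 1 - `|v + sup A *: x|.
have d0 : 0 < d by rewrite /d; lra.
have := gt1 (sup A + d) ltac:(lra); have := lip (sup A + d) (sup A).
by rewrite addrAC subrr add0r (gtr0_norm d0) /d; lra.
Qed.

(** * One-sided derivatives of the norm *)

(** By convexity the difference quotients are monotone in [r], so this infimum is the right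
    derivative of the norm at [w] in the direction [k]. The infimum gives a lower bound for all [r]
    at once, without a limit. *)
Definition dir_deriv (R : realType) (V : normedModType R) (w k : V) : R :=
  inf [set (`|w + r *: k| - `|w|) / r | r in [set r : R | 0 < r]].

Lemma dir_deriv_has_inf (R : realType) (V : normedModType R) (w k : V) :
  has_inf [set (`|w + r *: k| - `|w|) / r | r in [set r : R | 0 < r]].
Proof.
split; first by eexists; exists 1 => //=.
exists (- `|k|) => _ [r /= r0 <-].
rewrite ler_pdivlMr // mulNr.
have := lerB_normD w (r *: k); rewrite normrZ gtr0_norm //; lra.
Qed.

Lemma dir_deriv_lb (R : realType) (V : normedModType R) (w k : V) r :
  0 <= r -> `|w| + r * dir_deriv w k <= `|w + r *: k|.
Proof.
rewrite le_eqVlt => /orP[/eqP<-|r0]; first by rewrite mul0r scale0r !addr0.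
have [_ lb] := dir_deriv_has_inf w k.
have := ge_inf lb (ex_intro2 _ _ r r0 erefl).
by rewrite -/(dir_deriv w k) ler_pdivlMr //; lra.
Qed.

(** Once the difference quotient at some [d] is within [e] of the infimum, convexity keeps it there
    for all smaller [r]. *)
Lemma dir_deriv_ub (R : realType) (V : normedModType R) (w k : V) e : 0 < e ->
  exists2 d, 0 < d & forall r, 0 <= r -> r <= d ->
    `|w + r *: k| <= `|w| + r * dir_deriv w k + e * r.
Proof.
move=> e0; have [_ [d /= d0 <-] h] := inf_adherent e0 (dir_deriv_has_inf w k).
exists d => // r r0 rd.
have -> : w + r *: k = (1 - r / d) *: w + (r / d) *: (w + d *: k).
  rewrite scalerDr addrA -scalerDl subrK scale1r scalerA divfK //.
  by rewrite gt_eqF.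
have rd0 : 0 <= r / d by rewrite divr_ge0 // ltW.
have rd1 : r / d <= 1 by rewrite ler_pdivrMr // mul1r.
apply: le_trans (ler_normD _ _) _; rewrite (normrZ (1 - r / d)) (normrZ (r / d)) (ger0_norm rd0) ger0_norm ?subr_ge0 //.
rewrite -/(dir_deriv w k) in h; have := ler_wpM2l r0 (ltW h).
have -> : r * ((`|w + d *: k| - `|w|) / d) = r / d * (`|w + d *: k| - `|w|) by ring.
by lra.
Qed.

(* One-sided derivatives of [s |-> |w + s z|] at [0], glued into a function
   that is linear on each half-line. *)
Definition wedge (R : realType) (V : normedModType R) (w z : V) (s : R) : R :=
  if 0 <= s then s * dir_deriv w z else - s * dir_deriv w (- z).

(** The jump at [s = 0] of the derivative of [s |-> |w + s z|], whose left derivative is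
    [- dir_deriv w (- z)]. *)
Definition kink (R : realType) (V : normedModType R) (w z : V) : R :=
  dir_deriv w z + dir_deriv w (- z).

Lemma wedge_lb (R : realType) (V : normedModType R) (w z : V) m s :
  0 < m -> m * `|w| + wedge w z s <= `|m *: w + s *: z|.
Proof.
move=> m0; rewrite /wedge; have mn0 : m != 0 by rewrite gt_eqF.
have -> : m *: w + s *: z = m *: (w + (s / m) *: z).
  by rewrite scalerDr scalerA mulrC divfK.
rewrite normrZ gtr0_norm //; case: ifP => s0.
  have := dir_deriv_lb w z (divr_ge0 s0 (ltW m0)).
  rewrite -(ler_pM2l m0) mulrDr; suff -> : m * (s / m * dir_deriv w z) = s * dir_deriv w z by [].
  by field.
have s1 : 0 <= - s / m by rewrite divr_ge0 ?ltW //; move/negbT: s0; rewrite -ltNge; lra.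
have := dir_deriv_lb w (- z) s1.
rewrite -(ler_pM2l m0) mulrDr scalerN -scaleNr mulNr opprK.
suff -> : m * (- (s / m) * dir_deriv w (- z)) = - s * dir_deriv w (- z) by [].
by field.
Qed.

(** Homogeneity reduces to [m = 1]. The range allowed for [s] is therefore proportional to [m], and
    the expansion is uniform on a cone around [w]. *)
Lemma wedge_ub (R : realType) (V : normedModType R) (w z : V) e : 0 < e ->
  exists2 d, 0 < d & forall m s, 0 < m -> `|s| <= d * m ->
    `|m *: w + s *: z| <= m * `|w| + wedge w z s + e * `|s|.
Proof.
move=> e0; have [d1 d10 h1] := dir_deriv_ub w z e0.
have [d2 d20 h2] := dir_deriv_ub w (- z) e0.
exists (Num.min d1 d2); first by rewrite lt_min d10.
move=> m s m0; rewrite -ler_pdivrMr // le_min => /andP[sd1 sd2].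
rewrite /wedge; have mn0 : m != 0 by rewrite gt_eqF.
have -> : m *: w + s *: z = m *: (w + (s / m) *: z).
  by rewrite scalerDr scalerA mulrC divfK.
rewrite normrZ gtr0_norm //; case: ifP => s0.
  rewrite (ger0_norm s0) in sd1 *.
  have := h1 _ (divr_ge0 s0 (ltW m0)) sd1; rewrite -(ler_pM2l m0) !mulrDr.
  suff -> : m * (s / m * dir_deriv w z) = s * dir_deriv w z.
    by suff -> : m * (e * (s / m)) = e * s; [|field].
  by field.
have {}s0 : s <= 0 by move/negbT: s0; rewrite -ltNge; lra.
rewrite (ler0_norm s0) in sd2 *.
have s1 : 0 <= - s / m by rewrite divr_ge0 ?(ltW m0) //; lra.
have := h2 _ s1 sd2; rewrite -(ler_pM2l m0) !mulrDr scalerN -scaleNr mulNr opprK.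
suff -> : m * (- (s / m) * dir_deriv w (- z)) = - s * dir_deriv w (- z).
  by suff -> : m * (e * - (s / m)) = e * - s; [|field].
by field.
Qed.

Lemma wedgeDN (R : realType) (V : normedModType R) (w z : V) s :
  wedge w z s + wedge w z (- s) = kink w z * `|s|.
Proof.
rewrite /wedge /kink; case: (ltrgt0P s) => s0.
- by rewrite leNgt oppr_lt0 s0 /=; ring.
- by rewrite oppr_ge0 ltW //; ring.
- by rewrite s0 oppr0 lexx; ring.
Qed.

Lemma kink_ge0 (R : realType) (V : normedModType R) (w z : V) : 0 <= kink w z.
Proof.
apply/ler_addgt0Pr => e e0.
have [d d0 h] := wedge_ub w z (e := e / 2) ltac:(lra).
have d1 : `|d| <= d * 1 by rewrite mulr1 gtr0_norm.
have := h 1 d ltr01 d1; have := h 1 (- d) ltr01; rewrite normrN => /(_ d1).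
have := wedgeDN w z d; rewrite (gtr0_norm d0) !scale1r !mul1r scaleNr.
have := ler_normD (w + d *: z) (w - d *: z).
rewrite addrACA subrr addr0 -mulr2n normrMn mulr2n => h1 h2 h3 h4.
have : 0 <= (kink w z + e) * d by rewrite mulrDl; lra.
by rewrite pmulr_lge0.
Qed.

(** Frees [wedge_lb] from the positivity of the first coefficient: adding [k *: w] makes it positive
    and costs at most [k] in norm. *)
Lemma wedge_support (R : realType) (V : normedModType R) (w z : V) a b :
  `|w| = 1 -> a + wedge w z b <= `|a *: w + b *: z|.
Proof.
move=> w1; pose k := `|a| + 1.
have ak0 : 0 < a + k by rewrite /k; have := ler_norm (- a); rewrite normrN; lra.
have := wedge_lb w z b ak0; rewrite w1 mulr1.
have -> : (a + k) *: w + b *: z = (a *: w + b *: z) + k *: w.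
  by rewrite scalerDl addrAC.
have := ler_normD (a *: w + b *: z) (k *: w).
rewrite [X in _ <= _ + X]normrZ w1 mulr1 (@ger0_norm _ k) ?addr_ge0 //.
lra.
Qed.

Lemma wedge_linear (R : realType) (V : normedModType R) (w z : V) s :
  kink w z = 0 -> wedge w z s = s * dir_deriv w z.
Proof.
rewrite /kink /wedge => k0; case: ifP => // _.
have -> : dir_deriv w (- z) = - dir_deriv w z by lra.
by ring.
Qed.

(** * Kinks of the norm: relation to differentiability, and countability *)

(** Without a jump the wedge is linear, and [wedge_lb] with [wedge_ub] squeezes the norm onto the
    first-order expansion whose linear part is [a + b * g]. *)
Lemma kink_gt0_of_not_differentiable (R : realType) (V : normedModType R)
  (x z : V) : frame x z -> ~ differentiable (@normfun R V) x -> 0 < kink x z.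
Proof.
move=> fr nd; rewrite lt_neqAle kink_ge0 andbT; apply/negP => /eqP/esym k0.
apply: nd; pose g := dir_deriv x z.
have [L LE] := @frame_linear R V x z R^o 1 g fr.
have [K K0 LK] := frame_linear_bounded (W := R^o) L fr.
have cL : continuous (L : V -> R).
  move=> v; apply/cvgrPdist_le => e e0; near=> u.
  rewrite -linearB; apply: le_trans (LK _) _.
  rewrite mulrC -ler_pdivlMr //; near: u.
  apply/nbhs_ballP; exists (e / K); first by rewrite /= divr_gt0.
  by move=> u; rewrite -ball_normE => /ltW.
have Lo : @normfun R V \o shift x = cst (normfun x) + (L : V -> R) +o_ (0 : V) id.
  apply/eqaddoP => e e0.
  have [d d0 h] := wedge_ub x z e0.
  near=> v.
  have [x1 _ le span] := fr; have [a [b vE]] := span v.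
  (* The first bound keeps [1 + a] at least [1 / 2]; with the second, [b] falls in the range of
     [wedge_ub]. *)
  have r1 : `|v| <= 1 / 4 by near: v; apply: nbhs0_le; lra.
  have r2 : `|v| <= d / 2 by near: v; apply: nbhs0_le; lra.
  have := frame_coord1 a b fr; have := le a b; rewrite -vE => hb ha.
  have a1 : 0 < 1 + a by have := ler_norm (- a); rewrite normrN; lra.
  have bd : `|b| <= d * (1 + a).
    have : d * (1 / 2) <= d * (1 + a).
      by rewrite ler_pM2l //; have := ler_norm (- a); rewrite normrN; lra.
    by lra.
  have := h _ _ a1 bd; have := wedge_lb x z b a1.
  rewrite x1 (wedge_linear _ k0) -/g => h1 h2.
  have : `| `|v + x| - (`|x| + (L : V -> R) v)| <= e * `|v|; last by [].
  have -> : v + x = (1 + a) *: x + b *: z.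
    by rewrite vE scalerDl scale1r addrC addrA.
  have -> : L v = a + b * g by rewrite vE LE /GRing.scale /= mulr1.
  rewrite x1.
  apply: (@le_trans _ _ (e * `|b|)); last by rewrite ler_pM2l.
  by rewrite ler_norml; lra.
by apply/diff_locallyP; rewrite (diff_unique cL Lo).
Unshelve. all: by end_near. Qed.

(* A rational functional close to the middle of the normal cone at a kink
   attains its norm there only. *)
Lemma kink_exposed (R : realType) (V : normedModType R) (w z : V)
  (L1 L2 : {linear V -> R^o}) (g1 g2 : R) :
  frame w z -> 0 < kink w z ->
  (forall a b, g1 * L1 (a *: w + b *: z) + g2 * L2 (a *: w + b *: z) =
    a + b * ((dir_deriv w z - dir_deriv w (- z)) / 2)) ->
  exists q1 q2 : rat, forall v, `|v| = 1 -> v != w ->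
    ratr q1 * L1 v + ratr q2 * L2 v < ratr q1 * L1 w + ratr q2 * L2 w :> R.
Proof.
move=> fr k0 gE; have [w1 z1 le span] := fr.
set p := dir_deriv w z in gE; set m' := dir_deriv w (- z) in gE.
have pm : 0 < p + m' := k0.
pose M := `|L1 w| + `|L2 w| + `|L1 z| + `|L2 z| + 1.
have M0 : 0 < M by rewrite /M ltr_wpDl // !addr_ge0.
(* The bound [1 / 2] keeps [Q w] positive; the other one, proportional to the width [p + m'] of the
   normal cone, keeps [Q z] strictly between [- m' * Q w] and [p * Q w]. *)
pose t := Num.min (1 / 2) ((p + m') / 4 / (1 + `|m'| + `|p|)).
have N0 : 0 < 1 + `|m'| + `|p| by rewrite -addrA ltr_wpDr // addr_ge0.
have t0 : 0 < t by rewrite lt_min !divr_gt0 //; lra.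
have t1 : t <= 1 / 2 by rewrite ge_min lexx.
have t2 : t * (1 + `|m'| + `|p|) <= (p + m') / 4.
  by rewrite -ler_pdivlMr // ge_min lexx orbT.
pose h := t / M; have h0 : 0 < h by rewrite divr_gt0.
have near_rat (g : R) : exists q : rat, `|ratr q - g| <= h.
  have [|q] := @rat_in_itvoo R (g - h) (g + h); first by lra.
  by rewrite in_itv /= => hq; exists q; rewrite ler_norml; lra.
have [q1 hq1] := near_rat g1; have [q2 hq2] := near_rat g2.
exists q1, q2.
pose Q v : R := ratr q1 * L1 v + ratr q2 * L2 v.
have QE a b : Q (a *: w + b *: z) = a * Q w + b * Q z.
  by rewrite /Q !linearD !linearZ /= /GRing.scale /=; ring.
have close v : `|L1 v| + `|L2 v| <= M -> `|Q v - (g1 * L1 v + g2 * L2 v)| <= t.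
  move=> LM.
  have -> : Q v - (g1 * L1 v + g2 * L2 v) =
      (ratr q1 - g1) * L1 v + (ratr q2 - g2) * L2 v by rewrite /Q; ring.
  apply: le_trans (ler_normD _ _) _; rewrite !normrM.
  have := ler_wpM2r (normr_ge0 (L1 v)) hq1; have := ler_wpM2r (normr_ge0 (L2 v)) hq2.
  have : h * (`|L1 v| + `|L2 v|) <= t.
    by rewrite /h mulrAC ler_pdivrMr // ler_pM2l.
  by rewrite mulrDr; lra.
have Qw : `|Q w - 1| <= t.
  have := gE 1 0; rewrite scale1r scale0r addr0 mul0r addr0 => <-.
  by apply: close; rewrite /M; have := normr_ge0 (L1 z); have := normr_ge0 (L2 z); lra.
have Qz : `|Q z - (p - m') / 2| <= t.
  have := gE 0 1; rewrite scale1r scale0r add0r mul1r add0r => <-.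
  by apply: close; rewrite /M; have := normr_ge0 (L1 w); have := normr_ge0 (L2 w); lra.
have Qw0 : 0 < Q w by move: Qw; rewrite ler_norml; lra.
have dev s : `|s * (Q w - 1)| <= `|s| * t by rewrite normrM ler_wpM2l.
have Qp : Q z < p * Q w.
  have := dev p; move: Qz t2; rewrite !ler_norml !mulrDr mulr1.
  have : 0 <= t * `|m'| by rewrite mulr_ge0 // ltW.
  lra.
have Qm : - m' * Q w < Q z.
  have := dev m'; move: Qz t2; rewrite !ler_norml !mulrDr mulr1.
  have : 0 <= t * `|p| by rewrite mulr_ge0 // ltW.
  lra.
move=> v v1 vw; have [a [b vE]] := span v.
rewrite -/(Q v) -/(Q w) vE QE.
have := wedge_support z a b w1; rewrite -vE v1 /wedge -/p -/m'.
case: ifP => b0.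
- move: b0; rewrite le_eqVlt => /orP[/eqP b0|b0] hab.
    (* On the line through [w] the only other unit vector is [- w]. *)
    have a1 : a = -1.
      have : `|a| = 1 by rewrite -v1 vE -b0 scale0r addr0 normrZ w1 mulr1.
      case: (ger0P a) => ? ?; last by lra.
      by move: vw; rewrite vE -b0 scale0r addr0 (_ : a = 1) // scale1r eqxx.
    by rewrite -b0 a1; lra.
  have := ler_wpM2r (ltW Qw0) hab.
  have : b * Q z < b * (p * Q w) by rewrite ltr_pM2l.
  by rewrite mulrDl; lra.
- have {}b0 : b < 0 by move/negbT: b0; rewrite -ltNge.
  move=> hab; have := ler_wpM2r (ltW Qw0) hab.
  have : b * Q z < b * (- m' * Q w) by rewrite ltr_nM2l.
  by rewrite mulrDl; lra.
Qed.

(** A pair of rationals exposing a kink is a label from a countable set. Two distinct kinks with the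
    same label would each have to give the functional a value strictly larger than the other
    does. *)
Lemma countable_kinks (R : realType) (V : normedModType R) (e f : V) :
  frame e f ->
  countable [set w : V | exists2 z : V, frame w z & 0 < kink w z].
Proof.
move=> fr.
have [L1 L1E] := @frame_linear R V e f R^o 1 0 fr.
have [L2 L2E] := @frame_linear R V e f R^o 0 1 fr.
have [_ _ _ span] := fr.
have /choice [Q QP] : forall w, exists q : rat * rat,
    (exists2 z : V, frame w z & 0 < kink w z) -> forall v, `|v| = 1 -> v != w ->
    ratr q.1 * L1 v + ratr q.2 * L2 v < ratr q.1 * L1 w + ratr q.2 * L2 w :> R.
  move=> w.
  have [[z frw kw]|nk] := pselect (exists2 z : V, frame w z & 0 < kink w z); last first.
    by exists (0, 0) => /nk.
  (* The middle of the normal cone at [w]; [G e] and [G f] are its coefficients over the fixed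
     functionals [L1] and [L2]. *)
  have [G GE] := @frame_linear R V w z R^o 1 ((dir_deriv w z - dir_deriv w (- z)) / 2) frw.
  have [|q1 [q2 qP]] := @kink_exposed R V w z L1 L2 (G e) (G f) frw kw.
    move=> a b.
    have Gv v : G e * L1 v + G f * L2 v = G v.
      have [c [d ->]] := span v.
      by rewrite L1E L2E [in RHS]linearD !linearZ /= /GRing.scale /=; ring.
    by rewrite Gv GE /GRing.scale /= mulr1.
  by exists (q1, q2).
apply/countable_injP; exists (fun w => pickle (Q w)).
move=> v w; rewrite !inE => hv hw /(pcan_inj pickleK) eqQ.
apply/eqP/negPn/negP => vw.
have unit (u : V) : (exists2 z, frame u z & 0 < kink u z) -> `|u| = 1.
  by case=> z [].
have v1 := unit _ hv; have w1 := unit _ hw.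
have := QP w hw v v1 vw; rewrite eq_sym in vw.
by have := QP v hv w w1 vw; rewrite eqQ; lra.
Qed.

(** Otherwise, by the intermediate value theorem, the distance to [h c] takes every value of a
    nontrivial interval, which has positive Lebesgue measure and so is uncountable. *)
Lemma lipschitz_countable_range_constant (R : realType) (V : normedModType R)
  (h : R -> V) (A : set V) (c d K : R) : countable A -> c <= d ->
  (forall s t, c <= s <= d -> c <= t <= d -> `|h s - h t| <= K * `|s - t|) ->
  (forall t, c <= t <= d -> A (h t)) -> h d = h c.
Proof.
move=> cA cd hK hA; apply/eqP; rewrite -subr_eq0 -normr_le0 leNgt; apply/negP => r0.
set r := `|_| in r0.
have cB : countable ((fun v => `|v - h c|) @` A).
  by apply: sub_countable cA; exact: card_image_le.
have sub : `[0, r]%classic `<=` (fun v => `|v - h c|) @` A.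
  move=> s /=; rewrite in_itv /= => /andP[s0 sr].
  have [||t tcd <-] := @IVT R (fun t => `|h t - h c|) c d s cd.
  - apply: (@lipschitz_within_continuous _ _ _ _ K) => u t ucd tcd.
    apply: le_trans (ler_dist_dist _ _) _.
    by rewrite opprB addrA subrK; exact: hK.
  - rewrite subrr normr0 -/r minElt maxElt r0; lra.
  by exists (h t) => //; apply: hA; rewrite in_itv in tcd.
have : countable (`[0, r]%classic : set R).
  by apply: sub_countable cB; exact: subset_card_le.
move=> /countable_lebesgue_measure0; rewrite lebesgue_measure_itv /= lte_fin r0.
by move=> /eqP; rewrite oppr0 addr0 eqe gt_eqF.
Qed.

(** * An open arc of the sphere as a graph over the last coordinate *)

(** Since [t *: z] is interior to the ball, a point strictly between it and a point of the ball has
    norm below 1. *)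
Lemma arc_le (R : realType) (V : normedModType R) (x z : V) t a b :
  frame x z -> `|t| < 1 -> 0 < a -> `|a *: x + t *: z| = 1 ->
  `|b *: x + t *: z| <= 1 -> b <= a.
Proof.
move=> [_ z1 _ _] t1 a0 a1 b1; rewrite leNgt; apply/negP => ab.
have b0 : 0 < b by lra.
have r0 : 0 < a / b by rewrite divr_gt0.
have r1 : a / b < 1 by rewrite ltr_pdivrMr // mul1r.
have : `|a *: x + t *: z| < 1; last by rewrite a1 ltxx.
have -> : a *: x + t *: z = (1 - a / b) *: (t *: z) + (a / b) *: (b *: x + t *: z).
  rewrite scalerDr !scalerA divfK ?gt_eqF // addrCA -scalerDl.
  by congr (_ + _ *: _); ring.
apply: le_lt_trans (ler_normD _ _) _.
rewrite (normrZ (1 - a / b)) (normrZ (a / b)) normrZ z1 mulr1.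
rewrite gtr0_norm ?subr_gt0 // (gtr0_norm r0).
have := ler_wpM2l (ltW r0) b1.
have : (1 - a / b) * `|t| < (1 - a / b) * 1 by rewrite ltr_pM2l // subr_gt0.
lra.
Qed.

Lemma arc_exists (R : realType) (V : normedModType R) (x z : V) : frame x z ->
  exists a : R -> R,
  [/\ forall t, `|t| < 1 -> 0 < a t /\ `|a t *: x + t *: z| = 1,
      forall t b, `|t| < 1 -> 0 < b -> `|b *: x + t *: z| = 1 -> b = a t,
      forall e t, 0 < e -> `|t| <= 1 - e -> e <= a t
    & forall e s t, 0 < e -> `|s| <= 1 - e -> `|t| <= 1 - e ->
        `|a s - a t| <= 2 / e * `|s - t|].
Proof.
move=> fr; have [x1 z1 le span] := fr.
have /choice [a aP] : forall t, exists b : R,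
    `|t| < 1 -> 0 < b /\ `|b *: x + t *: z| = 1.
  move=> t; have [t1|t1] := ltrP `|t| 1; last by exists 0.
  have nt : `|t *: z| = `|t| by rewrite normrZ z1 mulr1.
  have [||s [s0 s1 _]] := @ray_exit R V (t *: z) x => //; first by rewrite nt ltW.
  exists s => _; split; last by rewrite addrC.
  rewrite lt_neqAle s0 andbT; apply/eqP => s00.
  by move: s1; rewrite -s00 scale0r addr0 nt => h; rewrite h ltxx in t1.
have a_max (t b : R) : `|t| < 1 -> `|b *: x + t *: z| <= 1 -> b <= a t.
  by move=> t1; have [a0 a1] := aP _ t1; exact: arc_le fr t1 a0 a1.
have lb (e t : R) : 0 < e -> `|t| <= 1 - e -> e <= a t.
  move=> e0 te; apply: (@le_trans _ _ (1 - `|t|)); first by lra.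
  apply: a_max; first by lra.
  apply: le_trans (ler_normD _ _) _; rewrite !normrZ x1 z1 !mulr1.
  by rewrite ger0_norm; lra.
exists a; split=> //.
- move=> t b t1 b0 b1; have [a0 a1] := aP _ t1.
  apply/eqP; rewrite eq_le a_max ?b1 //=.
  by apply: arc_le fr t1 b0 b1 _; rewrite a1.
- move=> e s t e0.
  suff half (u v : R) : `|u| <= 1 - e -> `|v| <= 1 - e -> a v - a u <= 2 / e * `|u - v|.
    by move=> se te; rewrite ler_norml -lerNl opprB half //= distrC half.
  move=> ue ve; have u1 : `|u| < 1 by lra.
  have v1 : `|v| < 1 by lra.
  have [au0 _] := aP _ u1; have [av0 avE] := aP _ v1.
  have av2 : a v <= 2.
    by have := frame_coord1 (a v) v fr; rewrite avE; have := ler_norm (a v); lra.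
  (* Shrinking the point over [v] by [1 - h] frees a margin [h * e], exactly what moving the last
     coordinate from [v] to [u] requires. If [h] exceeds 1, the bound [a v <= 2] suffices. *)
  pose h := `|u - v| / e.
  have h0 : 0 <= h by rewrite divr_ge0 // ltW.
  have -> : 2 / e * `|u - v| = 2 * h by rewrite /h; ring.
  have [h1|h1] := lerP h 1; last by lra.
  suff : (1 - h) * a v <= a u by have := ler_wpM2l h0 av2; lra.
  apply: a_max => //.
  have -> : ((1 - h) * a v) *: x + u *: z =
      (1 - h) *: (a v *: x + v *: z) + (u - v + h * v) *: z.
    rewrite scalerDr !scalerA -addrA -scalerDl.
    by congr (_ + _ *: _); ring.
  apply: le_trans (ler_normD _ _) _.
  rewrite (normrZ (1 - h)) (normrZ (u - v + _)) avE z1 !mulr1 ger0_norm ?subr_ge0 //.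
  have := ler_normD (u - v) (h * v); rewrite normrM (ger0_norm h0).
  have := ler_wpM2l h0 ve.
  have : `|u - v| = h * e by rewrite /h divfK // gt_eqF.
  by lra.
Qed.

(** * Parallel chords of the sphere and their images *)

(* [A] and [B] are the images of the two arcs of the sphere cut off by the
   line [R x], both parametrised by the last coordinate of the frame. *)
Record chords (R : realType) (X Y : normedModType R) (x z : X)
  (a : R -> R) (A B : R -> Y) : Prop := Chords {
  chords_lip : forall e : R, 0 < e -> exists2 C : R, 0 < C &
    forall s t, `|s| <= 1 - e -> `|t| <= 1 - e ->
    [/\ `|a s - a t| <= C * `|s - t|, `|A s - A t| <= C * `|s - t|
      & `|B s - B t| <= C * `|s - t|];
  chords_lb : forall e t : R, 0 < e -> `|t| <= 1 - e -> e <= a t;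
  chords_dist : forall s t : R, `|s| < 1 -> `|t| < 1 ->
    `|A s - B t| = `|(a s + a (- t)) *: x + (s - t) *: z| }.

Lemma chords_width (R : realType) (X Y : normedModType R) (x z : X)
  (a : R -> R) (A B : R -> Y) (e t : R) :
  chords x z a A B -> frame x z -> 0 < e -> `|t| <= 1 - e ->
  2 * e <= a t + a (- t) /\ `|A t - B t| = a t + a (- t).
Proof.
move=> [_ lb dist] [x1 _ _ _] e0 te.
have te' : `|- t| <= 1 - e by rewrite normrN.
have h1 := lb e t e0 te; have h2 := lb e _ e0 te'.
split; first by lra.
rewrite dist; try by lra.
by rewrite subrr scale0r addr0 normrZ x1 mulr1 ger0_norm //; lra.
Qed.

(* The excess of the diagonals of a thin trapezoid over its parallel sides is
   of first order exactly when these sides point to a kink of the norm. *)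
Lemma chords_direction_kink (R : realType) (X Y : normedModType R) (x z : X)
  (a : R -> R) (A B : R -> Y) (w z' : Y) (t : R) :
  chords x z a A B -> frame x z -> 0 < kink x z -> `|t| < 1 ->
  frame w z' -> A t - B t = (a t + a (- t)) *: w -> 0 < kink w z'.
Proof.
move=> ch fr J0 t1 fr' AB; rewrite lt_neqAle kink_ge0 andbT.
apply/negP => /eqP/esym k0.
pose e := (1 - `|t|) / 2; have e0 : 0 < e by rewrite /e; lra.
have eE : 1 - e = `|t| + e by rewrite /e; lra.
clearbody e; have te : `|t| <= 1 - e by lra.
have [C C0 lip] := chords_lip ch e0.
(* Second coordinates move by at most [C * r], so each diagonal contributes an error of at most
   [kink x z / 4 * r]. *)
have eps0 : 0 < kink x z / (4 * C) by rewrite divr_gt0 // mulr_gt0.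
have [d d0 ub] := wedge_ub w z' eps0.
have [w1 z1 le span] := fr'; have [x1 _ _ _] := fr.
(* In order: [s] stays within [1 - e]; the coefficients of [w] in the diagonals stay at least [e];
   the coefficients of [z'] stay in the range of [wedge_ub]. *)
pose r := Num.min e (Num.min (e / (2 * C)) (d * e / C)).
have r0 : 0 < r by rewrite !lt_min e0 !divr_gt0 ?mulr_gt0.
have re : r <= e by rewrite ge_min lexx.
have rC : 2 * (C * r) <= e.
  rewrite mulrA mulrC -ler_pdivlMr ?mulr_gt0 //.
  by rewrite /r !ge_min lexx !orbT.
have rd : C * r <= d * e.
  by rewrite mulrC -ler_pdivlMr // /r !ge_min lexx !orbT.
pose s := t + r.
have se : `|s| <= 1 - e.
  by apply: le_trans (ler_normD _ _) _; rewrite (gtr0_norm r0) eE; lra.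
have sr : s - t = r by rewrite /s addrAC subrr add0r.
have s1 : `|s| < 1 by lra.
have [_ lA lB] := lip s t se te; rewrite sr (gtr0_norm r0) in lA lB.
have [h1 [h2 hE]] := span (A s - A t); have [k1 [k2 kE]] := span (B s - B t).
have [lam_lb _] := chords_width ch fr e0 te.
have [_ lamsE] := chords_width ch fr e0 se.
set lam := a t + a (- t) in AB lam_lb.
have E1 : A s - B t = (lam + h1) *: w + h2 *: z'.
  by rewrite scalerDl -addrA -hE -AB addrC addrA subrK.
have E2 : A t - B s = (lam - k1) *: w + (- k2) *: z'.
  rewrite scalerBl -addrA -scaleNr -combN -kE -AB opprB addrA.
  by rewrite subrK.
have E3 : A s - B s = (lam + h1 - k1) *: w + (h2 - k2) *: z'.
  by rewrite -combB -kE -E1 opprB addrA subrK.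
have bh1 := frame_coord1 h1 h2 fr'; have bh2 := le h1 h2.
have bk1 := frame_coord1 k1 k2 fr'; have bk2 := le k1 k2.
rewrite -hE in bh1 bh2; rewrite -kE in bk1 bk2.
have p1 : e <= lam + h1.
  by have := ler_norm (- h1); rewrite normrN; lra.
have p2 : e <= lam - k1.
  by have := ler_norm k1; lra.
have q1 : `|h2| <= d * (lam + h1) by have := ler_wpM2l (ltW d0) p1; lra.
have q2 : `|- k2| <= d * (lam - k1).
  by rewrite normrN; have := ler_wpM2l (ltW d0) p2; lra.
have U1 := ub _ _ (lt_le_trans e0 p1) q1.
have U2 := ub _ _ (lt_le_trans e0 p2) q2.
have U3 := wedge_support z' (lam + h1 - k1) (h2 - k2) w1.
rewrite -E3 lamsE in U3; rewrite -E2 w1 mulr1 normrN in U2; rewrite -E1 w1 mulr1 in U1.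
rewrite !(wedge_linear _ k0) in U1 U2 U3.
have D1 := chords_dist ch s1 t1; have D2 := chords_dist ch t1 s1.
have := wedge_support z (a s + a (- t)) (s - t) x1; rewrite -D1.
have := wedge_support z (a t + a (- s)) (t - s) x1; rewrite -D2.
have -> : t - s = - r by rewrite -sr opprB.
rewrite sr => F2 F1; have F3 := wedgeDN x z r; rewrite (gtr0_norm r0) in F3.
have b1 : kink x z / (4 * C) * `|h2| <= kink x z / 4 * r.
  have : kink x z / (4 * C) * `|h2| <= kink x z / (4 * C) * (C * r).
    by rewrite ler_pM2l //; lra.
  suff -> : kink x z / (4 * C) * (C * r) = kink x z / 4 * r by [].
  by field; rewrite gt_eqF.
have b2 : kink x z / (4 * C) * `|k2| <= kink x z / 4 * r.
  have : kink x z / (4 * C) * `|k2| <= kink x z / (4 * C) * (C * r).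
    by rewrite ler_pM2l //; lra.
  suff -> : kink x z / (4 * C) * (C * r) = kink x z / 4 * r by [].
  by field; rewrite gt_eqF.
(* Measured in [X], the diagonals exceed the sides by at least [kink x z * r]; measured in [Y],
   where the linear wedges cancel, by at most half of that. *)
have Jr : 0 < kink x z * r by rewrite mulr_gt0.
rewrite /lam in U1 U2 U3; lra.
Qed.

(** The unit direction [w t] of the image chord is locally Lipschitz in [t] and always a kink of
    [Y], hence constant by countability. *)
Lemma chords_parallel (R : realType) (X Y : normedModType R) (x z : X)
  (a : R -> R) (A B : R -> Y) :
  chords x z a A B -> frame x z -> 0 < kink x z -> two_dimensional Y ->
  exists w z' : Y, [/\ frame w z', 0 < kink w z' &
    forall t : R, `|t| < 1 -> A t - B t = (a t + a (- t)) *: w].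
Proof.
move=> ch fr J0 dimY.
pose lam t := a t + a (- t).
pose w t := (lam t)^-1 *: (A t - B t).
have width e t : 0 < e -> `|t| <= 1 - e -> 2 * e <= lam t /\ `|A t - B t| = lam t.
  by move=> e0 te; exact: chords_width ch fr e0 te.
have e1 (t : R) : `|t| < 1 -> 0 < (1 - `|t|) /\ `|t| <= 1 - (1 - `|t|).
  by move=> t1; split; lra.
have lam0 (t : R) : `|t| < 1 -> 0 < lam t.
  by move=> t1; have [e0 te] := e1 _ t1; have [] := width _ _ e0 te; lra.
have wE (t : R) : `|t| < 1 -> A t - B t = lam t *: w t.
  by move=> t1; rewrite scalerA mulfV ?scale1r // gt_eqF // lam0.
have w1 (t : R) : `|t| < 1 -> `|w t| = 1.
  move=> t1; have [e0 te] := e1 _ t1; have [_ h] := width _ _ e0 te.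
  by rewrite normrZ h gtr0_norm ?invr_gt0 ?lam0 // mulVf // gt_eqF // lam0.
have wkink (t : R) : `|t| < 1 -> exists2 z', frame (w t) z' & 0 < kink (w t) z'.
  move=> t1; have [z' fr'] := frame_exists dimY (w1 _ t1).
  by exists z' => //; apply: (chords_direction_kink ch fr J0 t1 fr'); exact: wE.
have n0 : `|0 : R| < 1 by rewrite normr0.
have [z' fr' k'] := wkink 0 n0.
have cK := countable_kinks fr'.
have wlip e : 0 < e -> exists K, forall s t : R, `|s| <= 1 - e -> `|t| <= 1 - e ->
    `|w s - w t| <= K * `|s - t|.
  move=> e0; have [C C0 lip] := chords_lip ch e0.
  (* The chord vector and its length each vary by at most [2 * C] times the parameter increment, and
     the length is at least [2 * e]. *)
  exists (2 * C / e) => s t se te.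
  have s1 : `|s| < 1 by lra.
  have t1 : `|t| < 1 by lra.
  have [ls Ps] := width _ _ e0 se; have [lt Pt] := width _ _ e0 te.
  have ls0 := lam0 _ s1; have lt0 := lam0 _ t1.
  have [_ lA lB] := lip s t se te.
  have -> : w s - w t = (lam s)^-1 *: ((A s - B s) - (A t - B t)) +
      ((lam s)^-1 * (lam t - lam s)) *: w t.
    rewrite -scalerA -scalerDr scalerBl -wE // addrA subrK scalerBr.
    by rewrite scalerA mulVf ?scale1r // gt_eqF.
  set P := A s - B s - _.
  have nP : `|P| <= 2 * (C * `|s - t|).
    have -> : P = (A s - A t) - (B s - B t).
      by rewrite /P [in LHS]opprD addrACA -opprD.
    by apply: le_trans (ler_normB _ _) _; lra.
  have nl : `|lam t - lam s| <= `|P|.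
    by rewrite -Ps -Pt distrC; exact: ler_dist_dist.
  apply: le_trans (ler_normD _ _) _.
  rewrite [X in X + _]normrZ [X in _ + X]normrZ w1 // mulr1 normrM gtr0_norm ?invr_gt0 // -mulrDr.
  rewrite mulrC ler_pdivrMr //.
  have : 2 * C / e * `|s - t| * (2 * e) <= 2 * C / e * `|s - t| * lam s.
    by rewrite ler_wpM2l // mulr_ge0 // divr_ge0 ?mulr_ge0 // ltW.
  have -> : 2 * C / e * `|s - t| * (2 * e) = 4 * (C * `|s - t|).
    by field; rewrite gt_eqF.
  lra.
have wconst c d : -1 < c -> c <= d -> d < 1 -> w d = w c.
  move=> c1 cd d1; pose e := Num.min (1 + c) (1 - d).
  have e0 : 0 < e by rewrite lt_min; lra.
  have ec : e <= 1 + c by rewrite ge_min lexx.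
  have ed : e <= 1 - d by rewrite ge_min lexx orbT.
  have [K wK] := wlip _ e0.
  apply: (lipschitz_countable_range_constant cK cd (K := K)).
    by move=> s t scd tcd; apply: wK; rewrite ler_norml; lra.
  by move=> t tcd; apply: wkink; rewrite ltr_norml; lra.
exists (w 0), z'; split=> // t t1.
suff <- : w t = w 0 by exact: wE.
move: t1; rewrite ltr_norml => /andP[t1 t2].
have [t0|t0] := lerP 0 t; first by apply: wconst; lra.
by apply/esym/wconst; lra.
Qed.

Lemma wedge_homogeneous (R : realType) (V : normedModType R) (w z : V) (r s : R) :
  0 <= r -> wedge w z (r * s) = r * wedge w z s.
Proof.
rewrite le_eqVlt => /orP[/eqP<-|r0].
  by rewrite !mul0r /wedge lexx mul0r.
rewrite /wedge pmulr_rge0 //; case: ifP => _; ring.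
Qed.

(** The diagonal from [A s] to [B t] is expanded twice, along [x] in [X] and along [w] in [Y]. Both
    expansions contain [a t + a (- t)], which cancels. *)
Lemma chords_first_order (R : realType) (X Y : normedModType R) (x z : X)
  (a : R -> R) (A B : R -> Y) (w z' : Y) (f g : R -> R) :
  chords x z a A B -> frame x z -> frame w z' ->
  (forall t : R, `|t| < 1 -> A t - B t = (a t + a (- t)) *: w) ->
  (forall t, A t = f t *: w + g t *: z') ->
  forall e eps, 0 < e -> 0 < eps -> exists2 d, 0 < d & forall s t,
    `|s| <= 1 - e -> `|t| <= 1 - e -> `|s - t| < d ->
    `|(a s - a t + wedge x z (s - t)) - (f s - f t + wedge w z' (g s - g t))|
      <= eps * `|s - t|.
Proof.
move=> ch fr fr' AB AE e eps e0 eps0.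
have [C C0 lip] := chords_lip ch e0.
have epsC : 0 < eps / C by rewrite divr_gt0.
have [d1 d10 ub1] := wedge_ub x z eps0.
have [d2 d20 ub2] := wedge_ub w z' epsC.
pose d := Num.min (e / (2 * C)) (Num.min (d1 * e) (d2 * e / C)).
have d0 : 0 < d by rewrite !lt_min !divr_gt0 ?mulr_gt0.
exists d => // s t se te std.
have r1 : 2 * (C * `|s - t|) <= e.
  rewrite mulrA mulrC -ler_pdivlMr ?mulr_gt0 //.
  by apply: le_trans (ltW std) _; rewrite /d ge_min lexx.
have r2 : `|s - t| <= d1 * e.
  by apply: le_trans (ltW std) _; rewrite /d !ge_min lexx !orbT.
have r3 : C * `|s - t| <= d2 * e.
  rewrite mulrC -ler_pdivlMr //.
  by apply: le_trans (ltW std) _; rewrite /d !ge_min lexx !orbT.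
have s1 : `|s| < 1 by lra.
have t1 : `|t| < 1 by lra.
have [x1 _ _ _] := fr; have [w1 _ le _] := fr'.
have [_ lA _] := lip s t se te.
have [lam_lb _] := chords_width ch fr e0 te.
have te' : `|- t| <= 1 - e by rewrite normrN.
have as0 := chords_lb ch e0 se; have at0 := chords_lb ch e0 te'.
set lam := a t + a (- t) in lam_lb.
have hE : A s - A t = (f s - f t) *: w + (g s - g t) *: z' by rewrite !AE combB.
have bf := frame_coord1 (f s - f t) (g s - g t) fr'; have bg := le (f s - f t) (g s - g t).
rewrite -hE in bf bg.
have E1 : A s - B t = (lam + (f s - f t)) *: w + (g s - g t) *: z'.
  by rewrite scalerDl -addrA -hE -(AB _ t1) addrC addrA subrK.
have p1 : e <= a s + a (- t) by lra.
have p2 : e <= lam + (f s - f t).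
  by have := ler_norm (- (f s - f t)); rewrite normrN; lra.
have q1 : `|s - t| <= d1 * (a s + a (- t)) by have := ler_wpM2l (ltW d10) p1; lra.
have q2 : `|g s - g t| <= d2 * (lam + (f s - f t)).
  by have := ler_wpM2l (ltW d20) p2; lra.
have U1 := ub1 _ _ (lt_le_trans e0 p1) q1.
have U2 := ub2 _ _ (lt_le_trans e0 p2) q2.
have L1 := wedge_support z (a s + a (- t)) (s - t) x1.
have L2 := wedge_support z' (lam + (f s - f t)) (g s - g t) w1.
have D := chords_dist ch s1 t1.
rewrite -D x1 mulr1 in U1 L1; rewrite -E1 w1 mulr1 in U2 L2.
have b2 : eps / C * `|g s - g t| <= eps * `|s - t|.
  have : eps / C * `|g s - g t| <= eps / C * (C * `|s - t|).
    by rewrite ler_pM2l //; lra.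
  suff -> : eps / C * (C * `|s - t|) = eps * `|s - t| by [].
  by field; rewrite gt_eqF.
by rewrite /lam in U2 L2; rewrite ler_norml; lra.
Qed.

(** The first-order identity makes [g] infinitesimally isometric up to the factor [k], hence affine,
    and then gives [f - a] a constant slope. So [A] is an affine image of its arc, with [x] sent to
    [w]; subtracting the chord yields [B]. *)
Lemma chords_affine (R : realType) (X Y : normedModType R) (x z : X)
  (a : R -> R) (A B : R -> Y) :
  chords x z a A B -> frame x z -> 0 < kink x z -> two_dimensional Y ->
  exists (L : {linear X -> Y}) (c : Y), forall t : R, `|t| < 1 ->
    A t = L (a t *: x + t *: z) + c /\ B t = L (- a (- t) *: x + t *: z) + c.
Proof.
move=> ch fr J0 dimY.
have [w [z' [fr' J'0 AB]]] := chords_parallel ch fr J0 dimY.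
have [_ _ _ span] := fr'.
have /choice [fg fgE] : forall t, exists ab : R * R, A t = ab.1 *: w + ab.2 *: z'.
  by move=> t; have [b [c ->]] := span (A t); exists (b, c).
pose f t := (fg t).1; pose g t := (fg t).2.
have AE t : A t = f t *: w + g t *: z' by exact: fgE.
have FO := chords_first_order ch fr fr' AB AE.
pose k := kink x z / kink w z'; have k0 : 0 < k by rewrite divr_gt0.
have margin c d : -1 < c -> d < 1 -> exists2 e : R, 0 < e &
    forall s, c <= s -> s <= d -> `|s| <= 1 - e.
  move=> c1 d1; pose e := Num.min (1 + c) (1 - d).
  have e0 : 0 < e by rewrite lt_min; lra.
  have ec : e <= 1 + c by rewrite ge_min lexx.
  have ed : e <= 1 - d by rewrite ge_min lexx orbT.
  by exists e => // s cs sd; rewrite ler_norml; lra.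
have gi c d : -1 < c -> c <= d -> d < 1 -> `|g d - g c| = k * (d - c).
  move=> c1 cd d1; have [e e0 eP] := margin c d c1 d1.
  apply: isometric_of_infinitesimally_isometric => // eps eps0.
  have eps1 : 0 < eps * kink w z' / 2 by rewrite divr_gt0 // mulr_gt0.
  have [dl dl0 h] := FO e _ e0 eps1.
  exists dl => // s t cs st td ts.
  have sc := eP s cs (le_trans st td); have tc := eP t (le_trans cs st) td.
  have nts : `|t - s| = t - s by rewrite ger0_norm ?subr_ge0.
  (* Adding the estimates for the two orders of [s] and [t] cancels the increments of [a] and [f],
     and [wedgeDN] turns the wedges into kinks. *)
  have h1 := h t s tc sc; have h2 := h s t sc tc.
  rewrite distrC nts in h2; rewrite nts in h1.
  have {}h1 := h1 ts; have {}h2 := h2 ts.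
  have W1 := wedgeDN x z (t - s); have W2 := wedgeDN w z' (g t - g s).
  rewrite !opprB nts in W1 W2.
  rewrite -(ler_pM2l J'0) -[X in X * `|_|](gtr0_norm J'0) -normrM mulrBr.
  have -> : kink w z' * (k * (t - s)) = kink x z * (t - s).
    by rewrite /k; field; rewrite gt_eqF.
  by move: h1 h2; rewrite !ler_norml; lra.
clearbody k; have [sg _ gE] := affine_of_isometric k0 gi.
(* With [g] of slope [sg * k], the identity for increasing parameters leaves [m] as the slope of
   [f - a]. *)
pose m := wedge x z 1 - wedge w z' (sg * k).
have fE (t : R) : `|t| < 1 -> f t - a t - m * t = f 0 - a 0.
  have cst c d : -1 < c -> c <= d -> d < 1 ->
      f d - a d - m * d = f c - a c - m * c.
    move=> c1 cd d1; have [e e0 eP] := margin c d c1 d1.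
    apply: (@constant_of_small_increments _ (fun t => f t - a t - m * t)) => // eps eps0.
    have [dl dl0 h] := FO e _ e0 eps0.
    exists dl => // s u cs su ud us.
    have := h u s (eP u (le_trans cs su) ud) (eP s cs (le_trans su ud)).
    have us0 : 0 <= u - s by rewrite subr_ge0.
    rewrite (ger0_norm us0) => /(_ us).
    have -> : g u - g s = (u - s) * (sg * k).
      by rewrite (gE u) ?(gE s); [ring|lra|lra].
    have -> : wedge x z (u - s) = (u - s) * wedge x z 1.
      by rewrite -wedge_homogeneous // mulr1.
    rewrite (wedge_homogeneous _ _ _ us0) /m !ler_norml; lra.
  rewrite ltr_norml => /andP[t1 t2].
  have -> : f 0 - a 0 = f 0 - a 0 - m * 0 by ring.
  have [t0|t0] := lerP 0 t; first by apply: cst; lra.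
  by apply/esym/cst; lra.
have [L LE] := frame_linear w (m *: w + (sg * k) *: z') fr.
have {}LE b u : L (b *: x + u *: z) = (b + u * m) *: w + (u * (sg * k)) *: z'.
  by rewrite LE combZ addrA -scalerDl.
exists L, ((f 0 - a 0) *: w + g 0 *: z') => t t1.
have AtE : A t = L (a t *: x + t *: z) + ((f 0 - a 0) *: w + g 0 *: z').
  rewrite AE LE combD; congr (_ *: _ + _ *: _).
    by have := fE t t1; lra.
  by rewrite (gE t); [ring|rewrite ltr_norml in t1].
split=> //.
have -> : B t = A t - (a t + a (- t)) *: w by rewrite -(AB _ t1) opprB addrC subrK.
rewrite AtE !LE !combD addrAC -scalerBl.
by congr (_ *: _ + _ *: _); ring.
Qed.

(** * From the open arcs to the whole sphere, across the flat parts *)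

(** By central symmetry the lower point with last coordinate [t] is the opposite of the upper point
    over [- t], whence the coefficient [- a (- t)]. *)
Lemma sphere_isometry_chords (R : realType) (X Y : normedModType R) (x z : X)
  (tau : X -> Y) (a : R -> R) : frame x z ->
  (forall u v : X, `|u| = 1 -> `|v| = 1 -> `|tau u - tau v| = `|u - v|) ->
  (forall t : R, `|t| < 1 -> `|a t *: x + t *: z| = 1) ->
  (forall e t : R, 0 < e -> `|t| <= 1 - e -> e <= a t) ->
  (forall e s t : R, 0 < e -> `|s| <= 1 - e -> `|t| <= 1 - e ->
    `|a s - a t| <= 2 / e * `|s - t|) ->
  chords x z a (fun t => tau (a t *: x + t *: z))
    (fun t => tau (- a (- t) *: x + t *: z)).
Proof.
move=> fr iso aS alb alip; have [x1 z1 _ _] := fr.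
have bS (t : R) : `|t| < 1 -> `|- a (- t) *: x + t *: z| = 1.
  by move=> t1; rewrite -normrN combN opprK aS // normrN.
split=> //.
- move=> e e0; have C0 : 0 < 2 / e by rewrite divr_gt0.
  exists (2 / e + 1); first lra.
  have comb_le (b c d : R) : `|b| <= 2 / e * c -> `|d| = c ->
      `|b *: x + d *: z| <= (2 / e + 1) * c.
    move=> hb hd; apply: le_trans (ler_normD _ _) _.
    by rewrite !normrZ x1 z1 !mulr1 mulrDl mul1r lerD // hd.
  move=> s t se te.
  have s1 : `|s| < 1 by lra.
  have t1 : `|t| < 1 by lra.
  have st := alip e s t e0 se te.
  split.
  + by apply: le_trans st _; rewrite ler_wpM2r //; lra.
  + by rewrite iso ?aS // combB; exact: comb_le.
  + rewrite iso ?bS // combB; apply: comb_le => //.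
    have -> : `|s - t| = `|- s - - t| by rewrite -opprD normrN.
    have -> : - a (- s) - - a (- t) = - (a (- s) - a (- t)) by rewrite opprD.
    by rewrite normrN; apply: alip => //; rewrite normrN.
- by move=> s t s1 t1; rewrite iso ?aS ?bS // combB opprK.
Qed.

(** [phi] is the last coordinate of a frame at [x]: the excluded unit vectors, where it is 1 or -1,
    form the flat parts parallel to [x], possibly single points. The kernel is recorded in order to
    compare with an independent kink. *)
Lemma sphere_isometry_affine_off_flats (R : realType) (X Y : normedModType R)
  (x : X) (tau : X -> Y) :
  two_dimensional X -> two_dimensional Y -> `|x| = 1 ->
  ~ differentiable (@normfun R X) x ->
  (forall u v : X, `|u| = 1 -> `|v| = 1 -> `|tau u - tau v| = `|u - v|) ->
  exists (phi : {linear X -> R^o}) (L : {linear X -> Y}) (c : Y),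
  [/\ forall v, `|phi v : R| <= `|v|, phi x = 0,
      forall v, phi v = 0 -> exists b : R, v = b *: x
    & forall u, `|u| = 1 -> `|phi u : R| < 1 -> tau u = L u + c].
Proof.
move=> dimX dimY x1 nd iso.
have [z fr] := frame_exists dimX x1; have [_ z1 le span] := fr.
have J0 := kink_gt0_of_not_differentiable fr nd.
have [a [aS auniq alb alip]] := arc_exists fr.
have aS' (t : R) : `|t| < 1 -> `|a t *: x + t *: z| = 1 by case/aS.
have ch := sphere_isometry_chords fr iso aS' alb alip.
have [L [c Lc]] := chords_affine ch fr J0 dimY.
have [phi phiE] := @frame_linear R X x z R^o 0 1 fr.
have {}phiE (b d : R) : phi (b *: x + d *: z) = d.
  by rewrite phiE /GRing.scale /= mulr0 mulr1 add0r.
exists phi, L, c; split.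
- by move=> v; have [b [d ->]] := span v; rewrite phiE.
- by have := phiE 1 0; rewrite scale1r scale0r addr0.
- move=> v; have [b [d ->]] := span v; rewrite phiE => ->.
  by exists b; rewrite scale0r addr0.
move=> u; have [b [d ->]] := span u; rewrite phiE => u1 d1.
have [Ad Bd] := Lc _ d1.
case: (ltrgt0P b) => b0.
- by rewrite (auniq _ _ d1 b0 u1).
- have nd1 : `|- d| < 1 by rewrite normrN.
  have nu1 : `|(- b) *: x + (- d) *: z| = 1 by rewrite -combN normrN.
  have nb0 : 0 < - b by rewrite oppr_gt0.
  by have bE := auniq _ _ nd1 nb0 nu1; rewrite -(opprK b) bE.
- by move: u1 d1; rewrite b0 scale0r add0r normrZ z1 mulr1 => ->; rewrite ltxx.
Qed.

(** Both sides are Lipschitz on the sphere, with constants 1 and [K], so the equality passes to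
    limits. *)
Lemma isometry_affine_closed (R : realType) (X Y : normedModType R)
  (tau : X -> Y) (L : {linear X -> Y}) (c : Y) (K : R) (P : X) :
  (forall u v : X, `|u| = 1 -> `|v| = 1 -> `|tau u - tau v| = `|u - v|) ->
  0 < K -> (forall v, `|L v| <= K * `|v|) -> `|P| = 1 ->
  (forall e : R, 0 < e -> exists y : X,
    [/\ `|y| = 1, `|y - P| <= e & tau y = L y + c]) ->
  tau P = L P + c.
Proof.
move=> iso K0 LK P1 hy; apply/eqP; rewrite -subr_eq0 -normr_le0.
apply/ler_addgt0Pr => e e0; rewrite add0r.
have K1 : 0 < 1 + K by lra.
have [y [y1 yP yE]] := hy (e / (1 + K)) (divr_gt0 e0 K1).
have -> : tau P - (L P + c) = (tau P - tau y) + L (y - P).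
  rewrite linearB yE -[RHS]addrA !opprD; congr (_ + _).
  by rewrite [RHS]addrC addrACA subrr add0r.
apply: le_trans (ler_normD _ _) _; rewrite iso // distrC.
have := LK (y - P); have : (1 + K) * `|y - P| <= (1 + K) * (e / (1 + K)).
  by rewrite ler_pM2l.
have -> : (1 + K) * (e / (1 + K)) = e by field; rewrite gt_eqF.
lra.
Qed.

(** Pushing [P] outwards along [x] keeps [phi] and raises the norm above 1, so normalising strictly
    shrinks [phi]. The push and the rescaling each cost at most [e / 2]. *)
Lemma flat_endpoint_approx (R : realType) (X : normedModType R) (x P : X)
  (phi : {linear X -> R^o}) : `|x| = 1 -> phi x = 0 -> `|P| = 1 ->
  `|phi P : R| <= 1 -> (forall t : R, 0 < t -> 1 < `|P + t *: x|) ->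
  forall e : R, 0 < e -> exists y : X,
    [/\ `|y| = 1, `|y - P| <= e & `|phi y : R| < 1].
Proof.
move=> x1 phix P1 phiP out e e0.
pose n := `|P + (e / 2) *: x|.
have e2 : 0 < e / 2 by lra.
have n1 : 1 < n := out _ e2.
have n0 : 0 < n by lra.
have ne : n <= 1 + e / 2.
  by apply: le_trans (ler_normD _ _) _; rewrite P1 normrZ x1 mulr1 gtr0_norm.
exists (n^-1 *: (P + (e / 2) *: x)); split.
- by rewrite normrZ gtr0_norm ?invr_gt0 // mulVf // gt_eqF.
- have -> : n^-1 *: (P + (e / 2) *: x) - P =
      (n^-1 - 1) *: (P + (e / 2) *: x) + (e / 2) *: x.
    by rewrite scalerBl scale1r opprD addrA addrNK.
  apply: le_trans (ler_normD _ _) _.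
  rewrite normrZ -/n [X in _ + X]normrZ x1 mulr1 (gtr0_norm e2).
  have -> : `|n^-1 - 1| = 1 - n^-1.
    by rewrite distrC gtr0_norm // subr_gt0 invf_lt1.
  by rewrite mulrBl mul1r mulVf ?gt_eqF //; lra.
- rewrite linearZ linearD linearZ /= phix /GRing.scale /= mulr0 addr0 normrM.
  rewrite gtr0_norm ?invr_gt0 // mulrC ltr_pdivrMr // mul1r.
  lra.
Qed.

(** The ends of a flat part are limits of points where [phi] is below 1 in absolute value, so [L]
    and [c] describe [tau] there. Inside it [psi] is below 1 in absolute value, so [M] and [d]
    apply, and by closure also at the ends. Affine maps equal at both ends of a segment agree on
    it. *)
Lemma affine_across_flats (R : realType) (X Y : normedModType R) (x z : X)
  (tau : X -> Y) (phi psi : {linear X -> R^o}) (L M : {linear X -> Y}) (c d : Y) :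
  frame x z ->
  (forall u v : X, `|u| = 1 -> `|v| = 1 -> `|tau u - tau v| = `|u - v|) ->
  (forall v, `|phi v : R| <= `|v|) -> phi x = 0 ->
  (forall v, `|psi v : R| <= `|v|) -> psi x != 0 ->
  (forall u, `|u| = 1 -> `|phi u : R| < 1 -> tau u = L u + c) ->
  (forall u, `|u| = 1 -> `|psi u : R| < 1 -> tau u = M u + d) ->
  forall u, `|u| = 1 -> tau u = L u + c.
Proof.
move=> fr iso phi1 phix psi1 psix Lc Md u u1; have [x1 _ _ _] := fr.
have [phiu|phiu] := ltP (`|phi u : R|) 1; first exact: Lc.
have {}phiu : `|phi u : R| = 1.
  by apply/eqP; rewrite eq_le phiu andbT; have := phi1 u; rewrite u1.
have [K K0 LK] := frame_linear_bounded L fr.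
have [K' K'0 MK] := frame_linear_bounded M fr.
have phiE (r : R) : phi (u + r *: x) = phi u.
  by rewrite linearD linearZ /= phix /GRing.scale /= mulr0 addr0.
have endp (y : X) (s : R) : `|y| = 1 -> phi y = 0 -> (forall r : R, phi (u + r *: y) = phi u) ->
    `|u + s *: y| = 1 -> (forall t, s < t -> 1 < `|u + t *: y|) ->
    tau (u + s *: y) = L (u + s *: y) + c.
  move=> y1 phiy phiuy P1 out; apply: (isometry_affine_closed iso K0 LK P1) => e e0.
  have [||v [v1 vP phiv]] := @flat_endpoint_approx R X y (u + s *: y) phi y1 phiy P1 _ _ e e0.
  - by rewrite phiuy phiu.
  - by move=> t t0; rewrite -addrA -scalerDl; apply: out; lra.
  by exists v; split=> //; exact: Lc.
have u1' : `|u| <= 1 by rewrite u1.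
have nx1 : `|- x| = 1 by rewrite normrN.
have [s1 [s10 S1 out1]] := ray_exit u1' x1.
have [s2 [s20 S2 out2]] := ray_exit u1' nx1.
have E1 := endp x s1 x1 phix phiE S1 out1.
have E2 : tau (u + s2 *: (- x)) = L (u + s2 *: (- x)) + c.
  apply: endp => //; first by rewrite linearN phix oppr0.
  by move=> r; rewrite scalerN -scaleNr phiE.
(* If either parameter vanishes, [u] is itself an end of the flat part. *)
have [s1z|s1n] := eqVneq s1 0; first by move: E1; rewrite s1z scale0r addr0.
have [s2z|s2n] := eqVneq s2 0; first by move: E2; rewrite s2z scale0r addr0.
have {}s10 : 0 < s1 by rewrite lt_neqAle eq_sym s1n.
have {}s20 : 0 < s2 by rewrite lt_neqAle eq_sym s2n.
rewrite scalerN -scaleNr in S2 E2.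
have s120 : 0 < s1 + s2 by lra.
have inner (r : R) : - s2 < r -> r < s1 -> `|u + r *: x| = 1 /\ tau (u + r *: x) = M (u + r *: x) + d.
  move=> r2 r1.
  have n1 : `|u + r *: x| = 1.
    apply/eqP; rewrite eq_le; apply/andP; split; last first.
      by rewrite -phiu -(phiE r); exact: phi1.
    pose l := (r + s2) / (s1 + s2).
    have l0 : 0 <= l by rewrite divr_ge0 //; lra.
    have l1 : l <= 1 by rewrite ler_pdivrMr //; lra.
    have -> : u + r *: x = l *: (u + s1 *: x) + (1 - l) *: (u + (- s2) *: x).
      rewrite !scalerDr addrACA -scalerDl subrKC scale1r !scalerA -scalerDl.
      by congr (_ + _ *: _); rewrite /l; field; rewrite gt_eqF.
    apply: le_trans (ler_normD _ _) _.
    by rewrite (normrZ l) (normrZ (1 - l)) S1 S2 !mulr1 !ger0_norm ?subr_ge0 //; lra.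
  split=> //; apply: Md => //.
  have psiE (q : R) : psi (u + q *: x) = psi u + q * psi x :> R.
    by rewrite linearD linearZ.
  have := psi1 (u + s1 *: x); have := psi1 (u + (- s2) *: x); rewrite S1 S2 !psiE.
  rewrite !ler_norml ltr_norml mulNr.
  (* [psi] is strictly monotone along the segment and at most 1 in absolute value at its ends, hence
     strictly below 1 inside. *)
  have {}psix : (psi x : R) < 0 \/ 0 < (psi x : R) by apply/orP; rewrite -neq_lt.
  case: psix => psix.
    have : s1 * psi x < r * psi x by rewrite ltr_nM2r.
    have : r * psi x < (- s2) * psi x by rewrite ltr_nM2r.
    rewrite mulNr; lra.
  have : r * psi x < s1 * psi x by rewrite ltr_pM2r.
  have : (- s2) * psi x < r * psi x by rewrite ltr_pM2r.
  rewrite mulNr; lra.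
have cl (P : X) (s : R) : P = u + s *: x -> `|P| = 1 ->
    (forall e : R, 0 < e -> exists2 r : R, - s2 < r < s1 & `|r - s| <= e) ->
    tau P = M P + d.
  move=> PE P1 appr; apply: (isometry_affine_closed iso K'0 MK P1) => e e0.
  have [r /andP[r2 r1] rs] := appr e e0.
  have [n1 tE] := inner r r2 r1.
  exists (u + r *: x); split=> //.
  by rewrite PE opprD addrACA subrr add0r -scalerBl normrZ x1 mulr1.
have F1 : tau (u + s1 *: x) = M (u + s1 *: x) + d.
  apply: (cl _ s1) => // e e0; pose m := Num.min e s1.
  have m0 : 0 < m by rewrite lt_min e0.
  have me : m <= e by rewrite ge_min lexx.
  have ms : m <= s1 by rewrite ge_min lexx orbT.
  by exists (s1 - m); [lra|rewrite addrAC subrr add0r normrN gtr0_norm].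
have F2 : tau (u + (- s2) *: x) = M (u + (- s2) *: x) + d.
  apply: (cl _ (- s2)) => // e e0; pose m := Num.min e s2.
  have m0 : 0 < m by rewrite lt_min e0.
  have me : m <= e by rewrite ge_min lexx.
  have ms : m <= s2 by rewrite ge_min lexx orbT.
  by exists (- s2 + m); [lra|rewrite addrAC subrr add0r gtr0_norm].
have [|_ F0] := inner 0 _ s10; first by rewrite oppr_lt0.
rewrite scale0r addr0 in F0.
pose D v := (M v + d) - (L v + c).
have DE (r : R) : D (u + r *: x) = D u + r *: (M x - L x).
  have lin (N : {linear X -> Y}) : N (u + r *: x) = N u + r *: N x.
    by rewrite linearD linearZ.
  rewrite /D !lin scalerBr !opprD.
  by rewrite (addrAC (M u)) (addrAC (- L u)) addrACA.
have D1 : D (u + s1 *: x) = 0 by rewrite /D -F1 E1 subrr.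
have D2 : D (u + (- s2) *: x) = 0 by rewrite /D -F2 E2 subrr.
have : (s1 + s2) *: (M x - L x) = 0.
  have -> : (s1 + s2) *: (M x - L x) = D (u + s1 *: x) - D (u + (- s2) *: x).
    by rewrite !DE opprD addrACA subrr add0r scaleNr opprK -scalerDl.
  by rewrite D1 D2 subrr.
move=> /eqP; rewrite scaler_eq0 gt_eqF //= => /eqP ML.
have : D u = 0 by move: D1; rewrite DE ML scaler0 addr0.
by rewrite /D -F0 => /eqP; rewrite subr_eq0 => /eqP.
Qed.

(** * Vanishing of the translation part *)

Theorem theorem3 (R : realType) (X : normedModType R)
  (dimX : two_dimensional X)
  (pwX : sphere_piecewise_C1 X)
  (x xbar : X) (hx : `|x| = 1) (hxbar : `|xbar| = 1)
  (indep : lin_indep2 x xbar)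
  (ndx : ~ differentiable (@normfun R X) x)
  (ndxbar : ~ differentiable (@normfun R X) xbar) :
  forall (Y : normedModType R), two_dimensional Y ->
  forall tau : X -> Y,
    (forall u, `|u| = 1 -> `|tau u| = 1) ->
    (forall w : Y, `|w| = 1 -> exists2 u : X, `|u| = 1 & tau u = w) ->
    (forall u v : X, `|u| = 1 -> `|v| = 1 -> `|tau u - tau v| = `|u - v|) ->
    exists T : {linear X -> Y},
      (forall u : X, `|u| = 1 -> T u = tau u) /\
      (forall z : X, `|T z| = `|z|).
Proof.
move=> Y dimY tau sph surj iso.
have [phi [L [c [phi1 phix _ Lc]]]] :=
  sphere_isometry_affine_off_flats dimX dimY hx ndx iso.
have [psi [M [d [psi1 psixb kerpsi Md]]]] :=
  sphere_isometry_affine_off_flats dimX dimY hxbar ndxbar iso.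
have psix : psi x != 0.
  apply/eqP => /kerpsi [b xE].
  have := indep 1 (- b); rewrite scale1r scaleNr -xE subrr => /(_ erefl) [/eqP].
  by rewrite oner_eq0.
have [z fr] := frame_exists dimX hx.
have tauE := affine_across_flats fr iso phi1 phix psi1 psix Lc Md.
(* Antipodal points are at distance 2, and the translation cancels in the difference of their
   images. *)
have L1 u : `|u| = 1 -> `|L u| = 1.
  move=> u1; have nu1 : `|- u| = 1 by rewrite normrN.
  have := iso u (- u) u1 nu1; rewrite !tauE // linearN opprD addrACA subrr addr0.
  rewrite !opprK -!mulr2n !normrMn u1 => /eqP.
  by rewrite eqrMn2r => /eqP.
have Lnorm v : `|L v| = `|v|.
  have [->|v0] := eqVneq v 0; first by rewrite linear0 !normr0.
  have nv : `|v| != 0 by rewrite normr_eq0.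
  rewrite -[v in LHS]scale1r -(mulfV nv) -scalerA linearZ normrZ.
  by rewrite L1 ?normfZV // mulr1 normr_id.
have c0 : c = 0.
  (* The preimage of the antipode of [tau x] exhibits [c] as [L w]. *)
  have [v v1 vE] : exists2 v : X, `|v| = 1 & tau v = - tau x.
    by apply: surj; rewrite normrN; exact: sph.
  pose w := - 2^-1 *: (v + x).
  have Lw : L w = c.
    have Lvx : L (v + x) = - (2 *: c).
      apply/eqP; rewrite -subr_eq0 opprK linearD scaler_nat mulr2n addrACA.
      by rewrite -!tauE // vE addNr.
    by rewrite /w linearZ /= Lvx scaleNr scalerN opprK scalerA mulVf ?scale1r.
  clearbody w; apply/eqP; rewrite -normr_eq0 -Lw Lnorm normr_eq0; apply/negPn/negP => w0.
  (* At the unit vector along [w], the image under [tau] would have norm [1 + |w|] and leave the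
     sphere. *)
  have n0 : 0 < `|w| by rewrite normr_gt0.
  have u1 := normfZV w0; have := sph _ u1.
  have wE : `|w|^-1 *: w + w = (`|w|^-1 + 1) *: w by rewrite scalerDl scale1r.
  rewrite tauE // -Lw -linearD wE Lnorm normrZ.
  rewrite gtr0_norm ?addr_gt0 ?invr_gt0 // mulrDl mulVf ?gt_eqF // mul1r.
  lra.
by exists L; split=> // u u1; rewrite tauE // c0 addr0.
Qed.
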